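(* Let $\mathbb P=(P,\le,\Delta,f)$ be the syntactic forcing property over an at most countable transition-algebra signature $\Sigma$. For all conditions $p\in P$ and all sentences $\phi\in\mathrm{Sen}(\Delta_p)$: $p\Vdash^w\phi$ if and only if $\Gamma_p\vdash_{\Delta_p}\phi$.
   Context: Transition algebra (TA). A signature $\Sigma=(S,F\supseteq M,L)$ consists of sorts $S$, function symbols $F$ (constants have empty arity), monotonic function symbols $M\subseteq F$ and transition labels $L$; it is at most countable if $S,F,L$ are. Actions: $\mathfrak a::=\lambda\mid\mathfrak a\mathbin{;}\mathfrak a\mid\mathfrak a\cup\mathfrak a\mid\mathfrak a^*$ ($\lambda\in L$); $\mathfrak a^n$ is the $n$-fold composition (for $n=0$, $t_1\stackrel{\mathfrak a^0}\Rightarrow t_2$ is read as $t_1=t_2$). $\Sigma$-sentences: $\phi::=t_1=t_2\mid t_1\stackrel{\mathfrak a}\Rightarrow t_2\mid\neg\phi\mid\bigvee\Phi\mid\exists X\,\phi'$ (ground terms of equal sort, finite $\Phi$, finite variable set $X$ added as new constants giving $\Sigma[X]$, $\phi'\in\mathrm{Sen}(\Sigma[X])$); $\bot:=\bigvee\emptyset$. $T_\Sigma$: ground terms; substitutions $\theta\colon X\to T_\Sigma$ act on sentences. Atomic sentences: $t_1=t_2$, $t_1\stackrel{\lambda}\Rightarrow t_2$ ($\lambda\in L$), forming $\mathrm{Sen}_b(\Sigma)$. Models: many-sorted algebras (possibly empty carriers) with label relations, monotone for $M$; usual satisfaction. Dynamic entailment $\vdash$: the least family $\vdash_\Sigma\subseteq\mathcal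 P(\mathrm{Sen}(\Sigma))^2$ closed under Monotonicity, Transitivity, Union, Translation along signature morphisms, and the rules: (R) $\Gamma\vdash t=t$; (S),(T) symmetry/transitivity of $=$; (F) congruence for function symbols; (P) $\Gamma\vdash t_1=t_1'$, $\Gamma\vdash t_2=t_2'$, $\Gamma\vdash t_1\stackrel{\lambda}\Rightarrow t_2$ give $\Gamma\vdash t_1'\stackrel{\lambda}\Rightarrow t_2'$; (M) for $f\in M$, $\Gamma\vdash t_j\stackrel{\lambda}\Rightarrow u_j$ gives $\Gamma\vdash f(\dots,t_j,\dots)\stackrel{\lambda}\Rightarrow f(\dots,u_j,\dots)$; (Comp$_I$) from $t_1\stackrel{\mathfrak a_1}\Rightarrow t$ and $t\stackrel{\mathfrak a_2}\Rightarrow t_2$ infer $t_1\stackrel{\mathfrak a_1;\mathfrak a_2}\Rightarrow t_2$; (Comp$_E$) if $\Gamma\vdash_\Sigma t_1\stackrel{\mathfrak a_1;\mathfrak a_2}\Rightarrow t_2$ and $\Gamma\cup\{t_1\stackrel{\mathfrak a_1}\Rightarrow x,x\stackrel{\mathfrak a_2}\Rightarrow t_2\}\vdash_{\Sigma[x]}\phi$ ($x$ new constant) then $\Gamma\vdash_\Sigma\phi$; (Union$_I$) from $t_1\stackrel{\mathfrak a_i}\Rightarrow t_2$ infer $t_1\stackrel{\mathfrak a_1\cup\mathfrak a_2}\Rightarrow t_2$; (Union$_E$) if $\Gamma\vdash t_1\stackrel{\mathfrak a_1\cup\mathfrak a_2}\Rightarrow t_2$ and $\Gamma\cup\{t_1\stackrel{\mathfrak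 a_i}\Rightarrow t_2\}\vdash\phi$ for $i=1,2$ then $\Gamma\vdash\phi$; (Star$_I$) from $t_1\stackrel{\mathfrak a^n}\Rightarrow t_2$ infer $t_1\stackrel{\mathfrak a^*}\Rightarrow t_2$; (Star$_E$) if $\Gamma\vdash t_1\stackrel{\mathfrak a^*}\Rightarrow t_2$ and $\Gamma\cup\{t_1\stackrel{\mathfrak a^n}\Rightarrow t_2\}\vdash\phi$ for all $n\in\omega$ then $\Gamma\vdash\phi$; (Neg$_D$) $\neg\neg\phi\vdash$-to-$\phi$; (False) from $\bot$ anything; (Neg$_I$) $\Gamma\cup\{\phi\}\vdash\bot$ gives $\Gamma\vdash\neg\phi$; (Neg$_E$) $\Gamma\vdash\neg\phi$ gives $\Gamma\cup\{\phi\}\vdash\bot$; (Disj$_I$) $\Gamma\vdash\phi$, $\phi\in\Phi$ give $\Gamma\vdash\bigvee\Phi$; (Disj$_E$) $\Gamma\vdash\bigvee\Phi$ and $\Gamma\cup\{\phi\}\vdash\gamma$ for all $\phi\in\Phi$ give $\Gamma\vdash\gamma$; (Quant$_I$) $\Gamma\cup\{\phi\}\vdash_{\Sigma[X]}\gamma$ gives $\Gamma\cup\{\exists X\phi\}\vdash_\Sigma\gamma$; (Quant$_E$) the converse; (Subst) $\Gamma\vdash_\Sigma\theta(\phi)$ gives $\Gamma\vdash_\Sigma\exists X\phi$. Syntactic forcing property over $\Sigma$: fix an $S$-sorted set $C$ of new constants with $C_s$ countably infinite for each $s$. $P$ is the set of pairs $p=(\Delta_p,\Gamma_p)$ where $\Delta_p$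 is $\Sigma$ extended with a finite set $C_p\subseteq C$ of constants and $\Gamma_p\subseteq\mathrm{Sen}(\Delta_p)$ with $\Gamma_p\not\vdash_{\Delta_p}\bot$; $p\le q$ iff $\Delta_p\subseteq\Delta_q$ and $\Gamma_p\subseteq\Gamma_q$; $\Delta(p)=\Delta_p$; $f(p)=\Gamma_p\cap\mathrm{Sen}_b(\Delta_p)$. Forcing relation on this $\mathbb P$: $p\Vdash\varphi$ iff $\varphi\in f(p)$ (atomic); $p\Vdash t_1\stackrel{\mathfrak a_1;\mathfrak a_2}\Rightarrow t_2$ iff $p\Vdash t_1\stackrel{\mathfrak a_1}\Rightarrow t$ and $p\Vdash t\stackrel{\mathfrak a_2}\Rightarrow t_2$ for some $t\in T_{\Delta_p}$; $p\Vdash t_1\stackrel{\mathfrak a_1\cup\mathfrak a_2}\Rightarrow t_2$ iff $p$ forces one of $t_1\stackrel{\mathfrak a_i}\Rightarrow t_2$; $p\Vdash t_1\stackrel{\mathfrak a^*}\Rightarrow t_2$ iff $p\Vdash t_1\stackrel{\mathfrak a^n}\Rightarrow t_2$ for some $n$; $p\Vdash\neg\phi$ iff no $q\ge p$ forces $\phi$; $p\Vdash\bigvee\Phi$ iff $p$ forces some $\phi\in\Phi$; $p\Vdash\exists X\phi$ iff $p\Vdash\theta(\phi)$ for some $\theta\colon X\to T_{\Delta_p}$. Weak forcing: $p\Vdash^w\phi$ iff $p\Vdash\neg\neg\phi$. *)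

(* Defs.v *)
From mathcomp Require Import all_boot.
From mathcomp Require Import boolp classical_sets functions cardinality.
From Stdlib Require List.

Set Implicit Arguments.
Unset Strict Implicit.
Unset Printing Implicit Defensive.

Local Open Scope classical_set_scope.

(* A word of sorts of length n is a map 'I_n -> sorts, so that signature
   morphisms act on arities by composition; constants are the symbols with
   n = 0. *)
Record signature := Signature {
  sorts : Type;
  funs : forall n, ('I_n -> sorts) -> sorts -> Type;
  monotonic : forall n (w : 'I_n -> sorts) (s : sorts), set (funs w s);
  labels : Type }.

Definition symbol (Sg : signature) :=
  {n : nat & {w : 'I_n -> sorts Sg & {s : sorts Sg & funs w s}}}.

Definition countable_signature (Sg : signature) : Prop :=
  [/\ countable [set: sorts Sg], countable [set: symbol Sg]
    & countable [set: labels Sg]].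

Definition arity0 (A : Type) (n : nat) : Type := if n is 0 then A else void.

Definition arity0_map (A B : Type) (g : A -> B) (n : nat) :
    arity0 A n -> arity0 B n :=
  if n is 0 then g else id.

Definition arity0_elim (A : Type) (n : nat) : arity0 A n -> A :=
  match n return arity0 A n -> A with
  | 0 => id
  | _.+1 => fun v => match v with end
  end.

Definition noarg (T : 'I_0 -> Type) (i : 'I_0) : T i :=
  match notF (ltn_ord i) with end.

(* Sg extended with a sorted family C of new, non-monotonic constants *)
Definition ext (Sg : signature) (C : sorts Sg -> Type) : signature :=
  {| sorts := sorts Sg;
     funs := fun n w s => (funs w s + arity0 (C s) n)%type;
     monotonic := fun n w s f => if f is inl g then monotonic g else False;
     labels := labels Sg |}.

(* A finite sorted set of n variables is given by the sorts of its members. *)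
Definition vars (S : Type) (n : nat) (X : 'I_n -> S) (s : S) : Type :=
  {i : 'I_n | X i = s}.

Notation extv Sg X := (@ext Sg (vars X)).

Inductive term (Sg : signature) : sorts Sg -> Type :=
| App n (w : 'I_n -> sorts Sg) (s : sorts Sg) (f : funs w s)
      (ts : forall i, term (w i)) : term s.

Definition cst (Sg : signature) (C : sorts Sg -> Type) (s : sorts Sg)
    (c : C s) : term (Sg := ext C) s :=
  @App (ext C) 0 (fun=> s) s (inr c) (@noarg _).

Inductive action (L : Type) : Type :=
| Lbl of L
| Comp of action L & action L
| Cup of action L & action L
| Star of action L.

(* the (n+1)-fold composition of a *)
Fixpoint act_powS (L : Type) (a : action L) (n : nat) : action L :=
  if n is m.+1 then Comp a (act_powS a m) else a.

(* The seq in Disj stands for the finite set of its elements. *)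
Inductive sen (Sg : signature) : Type :=
| Eq (s : sorts Sg) (t1 t2 : term s)
| Tr (s : sorts Sg) (a : action (labels Sg)) (t1 t2 : term s)
| Neg (phi : sen Sg)
| Disj (Phi : seq (sen Sg))
| Ex n (X : 'I_n -> sorts Sg) (phi : sen (extv Sg X)).

Arguments Disj {Sg} Phi.
Arguments Ex {Sg n} X phi.

Definition bot (Sg : signature) : sen Sg := Disj [::].
Arguments bot {Sg}.

(* t1 =[a^n]=> t2 *)
Definition Tr_pow (Sg : signature) (s : sorts Sg) (a : action (labels Sg))
    (n : nat) (t1 t2 : term s) : sen Sg :=
  if n is m.+1 then Tr (act_powS a m) t1 t2 else Eq t1 t2.

Definition basic (Sg : signature) : set (sen Sg) := fun phi =>
  match phi with
  | Eq _ _ _ => True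
  | Tr _ (Lbl _) _ _ => True
  | _ => False
  end.

Record morphism (Sg Sg' : signature) := Morphism {
  msort : sorts Sg -> sorts Sg';
  mfun : forall n (w : 'I_n -> sorts Sg) (s : sorts Sg),
    funs w s -> funs (fun i => msort (w i)) (msort s);
  mlabel : labels Sg -> labels Sg';
  mmono : forall n (w : 'I_n -> sorts Sg) (s : sorts Sg) (f : funs w s),
    monotonic f -> monotonic (mfun f) }.

(* Common generalization of signature morphisms and of substitutions of terms
   for constants: a symbol is sent either to a symbol or, when it is a
   constant, to a term.  Going under a quantifier requires this generality. *)
Record subst (Sg Sg' : signature) := Subst {
  ssort : sorts Sg -> sorts Sg';
  sfun : forall n (w : 'I_n -> sorts Sg) (s : sorts Sg), funs w s ->
    (funs (fun i => ssort (w i)) (ssort s) + arity0 (term (ssort s)) n)%type;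
  slabel : labels Sg -> labels Sg' }.

Definition subst_of_mor (Sg Sg' : signature) (chi : morphism Sg Sg') :
    subst Sg Sg' :=
  {| ssort := msort chi;
     sfun := fun n w s f => inl (mfun chi f);
     slabel := mlabel chi |}.

Fixpoint term_subst (Sg Sg' : signature) (th : subst Sg Sg') (s : sorts Sg)
    (t : term s) : term (ssort th s) :=
  match t in term s return term (ssort th s) with
  | App n w s f ts =>
      match sfun th f with
      | inl g => App g (fun i => term_subst th (ts i))
      | inr u => arity0_elim u
      end
  end.

Fixpoint act_map (L L' : Type) (g : L -> L') (a : action L) : action L' :=
  match a with
  | Lbl l => Lbl (g l)
  | Comp a1 a2 => Comp (act_map g a1) (act_map g a2)
  | Cup a1 a2 => Cup (act_map g a1) (act_map g a2)
  | Star a1 => Star (act_map g a1)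
  end.

Definition ext_incl (Sg : signature) (C : sorts Sg -> Type) :
    morphism Sg (ext C) :=
  {| msort := id : sorts Sg -> sorts (ext C);
     mfun := fun n w s f => inl f;
     mlabel := id : labels Sg -> labels (ext C);
     mmono := fun n w s f hf => hf |}.

Definition ext_map_fun (Sg : signature) (C D : sorts Sg -> Type)
    (g : forall s, C s -> D s) n (w : 'I_n -> sorts Sg) (s : sorts Sg)
    (f : @funs (ext C) _ w s) : @funs (ext D) _ w s :=
  match f with
  | inl f => inl f
  | inr c => inr (arity0_map (@g s) c)
  end.

Lemma ext_map_mono (Sg : signature) (C D : sorts Sg -> Type)
    (g : forall s, C s -> D s) n (w : 'I_n -> sorts Sg) (s : sorts Sg)
    (f : @funs (ext C) _ w s) :
  monotonic f -> monotonic (ext_map_fun g f).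
Proof. by case: f. Qed.

Definition ext_map (Sg : signature) (C D : sorts Sg -> Type)
    (g : forall s, C s -> D s) : morphism (ext C) (ext D) :=
  {| msort := id : sorts (ext C) -> sorts (ext D);
     mfun := ext_map_fun g;
     mlabel := id : labels (ext C) -> labels (ext D);
     mmono := ext_map_mono g |}.

Definition vars_map (S S' : Type) (g : S -> S') n (X : 'I_n -> S) (s : S)
    (x : vars X s) : vars (fun i => g (X i)) (g s) :=
  let: exist i e := x in exist _ i (congr1 g e).

Definition lift (Sg Sg' : signature) (th : subst Sg Sg') n
    (X : 'I_n -> sorts Sg) :
    subst (extv Sg X) (extv Sg' (fun i => ssort th (X i))) :=
  {| ssort := ssort th : sorts (extv Sg X) -> sorts (extv Sg' _);
     sfun := fun m w s (f : @funs (extv Sg X) _ w s) =>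
       match f with
       | inl f =>
           match sfun th f with
           | inl g => inl (inl g)
           | inr u =>
               inr (arity0_map
                      (fun t => term_subst (subst_of_mor (ext_incl _)) t) u)
           end
       | inr x => inl (inr (arity0_map (@vars_map _ _ (ssort th) _ X s) x))
       end;
     slabel := slabel th : labels (extv Sg X) -> labels (extv Sg' _) |}.

Fixpoint sen_subst (Sg Sg' : signature) (th : subst Sg Sg') (phi : sen Sg) :
    sen Sg' :=
  match phi with
  | Eq _ t1 t2 => Eq (term_subst th t1) (term_subst th t2)
  | Tr _ a t1 t2 =>
      Tr (act_map (slabel th) a) (term_subst th t1) (term_subst th t2)
  | Neg phi => Neg (sen_subst th phi)
  | Disj Phi => Disj (map (sen_subst th) Phi)
  | Ex _ X phi => Ex (fun i => ssort th (X i)) (sen_subst (lift th X) phi)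
  end.

Definition term_tr (Sg Sg' : signature) (chi : morphism Sg Sg') (s : sorts Sg)
    (t : term s) : term (msort chi s) := term_subst (subst_of_mor chi) t.

Definition sen_tr (Sg Sg' : signature) (chi : morphism Sg Sg') :
    sen Sg -> sen Sg' := sen_subst (subst_of_mor chi).

(* the substitution Sg[C] -> Sg determined by th : C -> T_Sg *)
Definition inst (Sg : signature) (C : sorts Sg -> Type)
    (th : forall s, C s -> term s) : subst (ext C) Sg :=
  {| ssort := id : sorts (ext C) -> sorts Sg;
     sfun := fun n w s (f : @funs (ext C) _ w s) =>
       match f with
       | inl f => inl f
       | inr c => inr (arity0_map (@th s) c)
       end;
     slabel := id : labels (ext C) -> labels Sg |}.

Notation upv X := (sen_tr (ext_incl (vars X))).
Notation uptv X := (term_tr (ext_incl (vars X))).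

Definition var1 (Sg : signature) (s : sorts Sg) : 'I_1 -> sorts Sg := fun=> s.
Definition x1 (Sg : signature) (s : sorts Sg) :
    term (Sg := extv Sg (var1 s)) s :=
  cst (C := vars (var1 s)) (exist _ ord0 (erefl s)).

Reserved Notation "G |-- P" (at level 70, no associativity).
Reserved Notation "G |-1 p" (at level 70, no associativity).

Inductive entails :
    forall Sg : signature, set (sen Sg) -> set (sen Sg) -> Prop :=
| Monotonicity Sg (G P : set (sen Sg)) : P `<=` G -> G |-- P
| Transitivity Sg (G P Q : set (sen Sg)) : G |-- P -> P |-- Q -> G |-- Q
| Unions Sg (G P : set (sen Sg)) : (forall phi, P phi -> G |-1 phi) -> G |-- P
| Translation Sg Sg' (chi : morphism Sg Sg') (G P : set (sen Sg)) :
    G |-- P -> sen_tr chi @` G |-- sen_tr chi @` P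
| Rule_R Sg (G : set (sen Sg)) s (t : term s) : G |-1 Eq t t
| Rule_S Sg (G : set (sen Sg)) s (t1 t2 : term s) :
    G |-1 Eq t1 t2 -> G |-1 Eq t2 t1
| Rule_T Sg (G : set (sen Sg)) s (t1 t2 t3 : term s) :
    G |-1 Eq t1 t2 -> G |-1 Eq t2 t3 -> G |-1 Eq t1 t3
| Rule_F Sg (G : set (sen Sg)) n (w : 'I_n -> sorts Sg) s (f : funs w s)
    (ts us : forall i, term (w i)) :
    (forall i, G |-1 Eq (ts i) (us i)) -> G |-1 Eq (App f ts) (App f us)
| Rule_P Sg (G : set (sen Sg)) s (l : labels Sg) (t1 t2 u1 u2 : term s) :
    G |-1 Eq t1 u1 -> G |-1 Eq t2 u2 -> G |-1 Tr (Lbl l) t1 t2 ->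
    G |-1 Tr (Lbl l) u1 u2
| Rule_M Sg (G : set (sen Sg)) n (w : 'I_n -> sorts Sg) s (f : funs w s)
    (l : labels Sg) (ts us : forall i, term (w i)) (j : 'I_n) :
    monotonic f -> (forall i, i <> j -> us i = ts i) ->
    G |-1 Tr (Lbl l) (ts j) (us j) ->
    G |-1 Tr (Lbl l) (App f ts) (App f us)
| Comp_I Sg (G : set (sen Sg)) s a1 a2 (t1 t t2 : term s) :
    G |-1 Tr a1 t1 t -> G |-1 Tr a2 t t2 -> G |-1 Tr (Comp a1 a2) t1 t2
| Comp_E Sg (G : set (sen Sg)) s a1 a2 (t1 t2 : term s) (phi : sen Sg) :
    G |-1 Tr (Comp a1 a2) t1 t2 ->
    upv (var1 s) @` G `|`
      [set Tr (Sg := extv Sg (var1 s)) a1 (uptv (var1 s) t1) (x1 s);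
           Tr (Sg := extv Sg (var1 s)) a2 (x1 s) (uptv (var1 s) t2)]
      |-1 upv (var1 s) phi ->
    G |-1 phi
| Union_I1 Sg (G : set (sen Sg)) s a1 a2 (t1 t2 : term s) :
    G |-1 Tr a1 t1 t2 -> G |-1 Tr (Cup a1 a2) t1 t2
| Union_I2 Sg (G : set (sen Sg)) s a1 a2 (t1 t2 : term s) :
    G |-1 Tr a2 t1 t2 -> G |-1 Tr (Cup a1 a2) t1 t2
| Union_E Sg (G : set (sen Sg)) s a1 a2 (t1 t2 : term s) (phi : sen Sg) :
    G |-1 Tr (Cup a1 a2) t1 t2 ->
    G `|` [set Tr a1 t1 t2] |-1 phi -> G `|` [set Tr a2 t1 t2] |-1 phi ->
    G |-1 phi
| Star_I Sg (G : set (sen Sg)) s a (t1 t2 : term s) n :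
    G |-1 Tr_pow a n t1 t2 -> G |-1 Tr (Star a) t1 t2
| Star_E Sg (G : set (sen Sg)) s a (t1 t2 : term s) (phi : sen Sg) :
    G |-1 Tr (Star a) t1 t2 ->
    (forall n, G `|` [set Tr_pow a n t1 t2] |-1 phi) ->
    G |-1 phi
| Neg_D Sg (G : set (sen Sg)) (phi : sen Sg) :
    G |-1 Neg (Neg phi) -> G |-1 phi
| False_E Sg (G : set (sen Sg)) (phi : sen Sg) : G |-1 bot -> G |-1 phi
| Neg_I Sg (G : set (sen Sg)) (phi : sen Sg) :
    G `|` [set phi] |-1 bot -> G |-1 Neg phi
| Neg_E Sg (G : set (sen Sg)) (phi : sen Sg) :
    G |-1 Neg phi -> G `|` [set phi] |-1 bot
| Disj_I Sg (G : set (sen Sg)) (Phi : seq (sen Sg)) (phi : sen Sg) :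
    G |-1 phi -> List.In phi Phi -> G |-1 Disj Phi
| Disj_E Sg (G : set (sen Sg)) (Phi : seq (sen Sg)) (gam : sen Sg) :
    G |-1 Disj Phi ->
    (forall phi, List.In phi Phi -> G `|` [set phi] |-1 gam) ->
    G |-1 gam
| Quant_I Sg (G : set (sen Sg)) n (X : 'I_n -> sorts Sg)
    (phi : sen (extv Sg X)) (gam : sen Sg) :
    upv X @` G `|` [set phi] |-1 upv X gam -> G `|` [set Ex X phi] |-1 gam
| Quant_E Sg (G : set (sen Sg)) n (X : 'I_n -> sorts Sg)
    (phi : sen (extv Sg X)) (gam : sen Sg) :
    G `|` [set Ex X phi] |-1 gam -> upv X @` G `|` [set phi] |-1 upv X gam
| Rule_Subst Sg (G : set (sen Sg)) n (X : 'I_n -> sorts Sg)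
    (phi : sen (extv Sg X)) (th : forall s, vars X s -> term s) :
    G |-1 sen_subst (inst th) phi -> G |-1 Ex X phi
where "G |-- P" := (entails G P)
  and "G |-1 p" := (entails G (set1 p)).

Section Forcing.
Variables (Sg : signature) (C : sorts Sg -> Type).

Definition Delta_consts (D : set {s : sorts Sg & C s}) (s : sorts Sg) : Type :=
  [set c : C s | D (existT C s c)].

Definition Delta (D : set {s : sorts Sg & C s}) : signature :=
  ext (Delta_consts D).

Definition Delta_incl_fun (D E : set {s : sorts Sg & C s}) (h : D `<=` E)
    (s : sorts Sg) (c : Delta_consts D s) : Delta_consts E s :=
  exist _ (val c) (mem_set (h _ (set_mem (valP c)))).

Definition Delta_incl (D E : set {s : sorts Sg & C s}) (h : D `<=` E) :
    morphism (Delta D) (Delta E) := ext_map (Delta_incl_fun h).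

Record condition := Condition {
  consts : set {s : sorts Sg & C s};
  consts_finite : finite_set consts;
  axs : set (sen (Delta consts));
  axs_consistent : ~ entails axs [set bot] }.

Arguments axs c _ : clear implicits.

Record cond_le (p q : condition) : Prop := CondLe {
  le_consts : consts p `<=` consts q;
  le_axs : sen_tr (Delta_incl le_consts) @` axs p `<=` axs q }.

Definition Delta_of (p : condition) : signature := Delta (consts p).

Definition atoms (p : condition) : set (sen (Delta_of p)) :=
  axs p `&` @basic (Delta_of p).

Arguments atoms p _ : clear implicits.

(* The star clause is the result of unfolding the clauses for equations and
   for composition in "p forces t1 =[a^n]=> t2 for some n". *)
Fixpoint forces_tr (p : condition) (s : sorts (Delta_of p))
    (a : action (labels (Delta_of p))) (t1 t2 : term s) : Prop :=
  match a with
  | Lbl l => atoms p (Tr (Lbl l) t1 t2)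
  | Comp a1 a2 => exists t, forces_tr a1 t1 t /\ forces_tr a2 t t2
  | Cup a1 a2 => forces_tr a1 t1 t2 \/ forces_tr a2 t1 t2
  | Star a1 =>
      let fix powS (n : nat) (u1 u2 : term s) : Prop :=
        if n is m.+1 then exists t, forces_tr a1 u1 t /\ powS m t u2
        else forces_tr a1 u1 u2 in
      exists n, if n is m.+1 then powS m t1 t2 else atoms p (Eq t1 t2)
  end.

End Forcing.

Arguments axs {Sg C} c _.
Arguments atoms {Sg C} p _.

Fixpoint depth (Sg : signature) (phi : sen Sg) : nat :=
  match phi with
  | Eq _ _ _ | Tr _ _ _ _ => 0
  | Neg phi => (depth phi).+1
  | Disj Phi => (foldr (fun psi m => maxn (depth psi) m) 0 Phi).+1
  | Ex _ _ phi => (depth phi).+1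
  end.

(* Forcing is defined by recursion on the depth of sentences, which is
   invariant under substitution; the lemmas forces_Eq, ..., forces_Ex below
   are its defining clauses. *)
Fixpoint forces_at (Sg : signature) (C : sorts Sg -> Type) (k : nat)
    (p : condition C) (phi : sen (Delta_of p)) {struct k} : Prop :=
  match phi, k with
  | Eq _ t1 t2, _ => atoms p (Eq t1 t2)
  | Tr _ a t1 t2, _ => forces_tr a t1 t2
  | Neg psi, k.+1 =>
      forall (q : condition C) (h : cond_le p q),
        ~ forces_at k (p := q) (sen_tr (Delta_incl (le_consts h)) psi)
  | Disj Phi, k.+1 => exists psi, List.In psi Phi /\ forces_at k psi
  | Ex _ X psi, k.+1 =>
      exists th : (forall s, vars X s -> term s),
        forces_at k (p := p) (sen_subst (inst th) psi)
  | _, 0 => False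
  end.

Definition forces (Sg : signature) (C : sorts Sg -> Type) (p : condition C)
    (phi : sen (Delta_of p)) : Prop := forces_at (depth phi) phi.

Definition weak_forces (Sg : signature) (C : sorts Sg -> Type)
    (p : condition C) (phi : sen (Delta_of p)) : Prop :=
  forces (Neg (Neg phi)).

Arguments forces {Sg C} p phi.
Arguments weak_forces {Sg C} p phi.

Lemma depth_subst (Sg Sg' : signature) (th : subst Sg Sg') (phi : sen Sg) :
  depth (sen_subst th phi) = depth phi.
Proof.
move: Sg Sg' th phi.
fix IH 4 => Sg Sg' th [s t1 t2|s a t1 t2|psi|Phi|n X psi] //=.
- by rewrite IH.
- congr _.+1; elim: Phi => [//|psi Phi IHPhi] /=.
  by rewrite IH IHPhi.
- by rewrite IH.
Qed.

Lemma depth_Disj (Sg : signature) (Phi : seq (sen Sg)) (phi : sen Sg) :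
  List.In phi Phi -> depth phi < depth (Disj Phi).
Proof.
rewrite /= ltnS; elim: Phi => [//|chi Phi IH] /= [<-|/IH le].
  exact: leq_maxl.
exact: leq_trans le (leq_maxr _ _).
Qed.

Lemma forces_at_stable (Sg : signature) (C : sorts Sg -> Type) (k m : nat)
    (p : condition C) (phi : sen (Delta_of p)) :
  depth phi <= k -> depth phi <= m -> forces_at k phi <-> forces_at m phi.
Proof.
elim: k m p phi => [|k IH] [|m] p phi;
  case: phi => [s t1 t2|s a t1 t2|psi|Phi|n X psi] //= hk hm.
- split=> H q h.
    by rewrite -(IH m) ?depth_subst //; exact: H.
  by rewrite (IH m) ?depth_subst //; exact: H.
- by split=> -[psi [hin H]]; exists psi; split => //; move: H;
    rewrite (IH m) // -ltnS (leq_trans (depth_Disj hin)).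
- by split=> -[th H]; exists th; move: H; rewrite (IH m) ?depth_subst.
Qed.

Lemma forces_at_ge (Sg : signature) (C : sorts Sg -> Type) (k : nat)
    (p : condition C) (phi : sen (Delta_of p)) :
  depth phi <= k -> forces_at k phi <-> forces p phi.
Proof. by move=> hk; apply: forces_at_stable. Qed.

Section ForcesClauses.
Variables (Sg : signature) (C : sorts Sg -> Type) (p : condition C).

Lemma forces_Eq s (t1 t2 : term (Sg := Delta_of p) s) :
  forces p (Eq t1 t2) <-> atoms p (Eq t1 t2).
Proof. by []. Qed.

Lemma forces_Lbl s l (t1 t2 : term (Sg := Delta_of p) s) :
  forces p (Tr (Lbl l) t1 t2) <-> atoms p (Tr (Lbl l) t1 t2).
Proof. by []. Qed.

Lemma forces_Comp s a1 a2 (t1 t2 : term (Sg := Delta_of p) s) :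
  forces p (Tr (Comp a1 a2) t1 t2) <->
  exists t, forces p (Tr a1 t1 t) /\ forces p (Tr a2 t t2).
Proof. by []. Qed.

Lemma forces_Cup s a1 a2 (t1 t2 : term (Sg := Delta_of p) s) :
  forces p (Tr (Cup a1 a2) t1 t2) <->
  forces p (Tr a1 t1 t2) \/ forces p (Tr a2 t1 t2).
Proof. by []. Qed.

Lemma forces_Star s a (t1 t2 : term (Sg := Delta_of p) s) :
  forces p (Tr (Star a) t1 t2) <-> exists n, forces p (Tr_pow a n t1 t2).
Proof.
rewrite /forces /=; set pw := (fix powS (n : nat) (u1 u2 : term s) := _).
have pwE n u1 u2 : pw n u1 u2 <-> forces_tr (act_powS a n) u1 u2.
  elim: n u1 u2 => [//|n IH] u1 u2 /=.
  by split=> -[t [? ?]]; exists t; split => //; apply/IH.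
by split=> -[[|n] H]; [exists 0|exists n.+1|exists 0|exists n.+1] => //=;
  apply/pwE.
Qed.

Lemma forces_Neg (phi : sen (Delta_of p)) :
  forces p (Neg phi) <->
  forall (q : condition C) (h : cond_le p q),
    ~ forces q (sen_tr (Delta_incl (le_consts h)) phi).
Proof.
rewrite {1}/forces /=; split=> H q h; move: (H q h).
  by rewrite forces_at_ge ?depth_subst.
by rewrite forces_at_ge ?depth_subst.
Qed.

Lemma forces_Disj (Phi : seq (sen (Delta_of p))) :
  forces p (Disj Phi) <-> exists phi, List.In phi Phi /\ forces p phi.
Proof.
rewrite {1}/forces /=.
by split=> -[psi [hin H]]; exists psi; split => //; move: H;
  rewrite forces_at_ge // -ltnS; exact: depth_Disj.
Qed.

Lemma forces_Ex n (X : 'I_n -> sorts (Delta_of p))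
    (phi : sen (extv (Delta_of p) X)) :
  forces p (Ex X phi) <->
  exists th : (forall s, vars X s -> term s),
    forces p (sen_subst (inst th) phi).
Proof.
rewrite {1}/forces /=.
by split=> -[th H]; exists th; move: H; rewrite forces_at_ge ?depth_subst.
Qed.

End ForcesClauses.

(* Main.v *)
(** Forcing and provability agree up to passing to a stronger condition: if [p]
    forces [phi] then [axs p] proves [phi], and if [axs p] proves [phi] then
    some [q] above [p] forces [phi].  The two are proved together by induction
    on the depth of [phi], because each of them for a negation uses the other.
    Each elimination rule, read contrapositively, says that a consistent theory
    proving a compound sentence has a consistent extension by a component of
    it; for compositions and existential quantifiers the witnesses are fresh
    constants taken from [C], which are available because a condition uses only
    finitely many.  Finally, a sentence proved above every extension of [p] is
    already proved by [axs p], since otherwise its negation could be added to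
    [axs p]; this absorbs the passage to stronger conditions. *)

Require Import Defs.
From mathcomp Require Import all_boot.
From mathcomp Require Import boolp classical_sets functions cardinality.

Set Implicit Arguments.
Unset Strict Implicit.
Unset Printing Implicit Defensive.

Local Open Scope classical_set_scope.
Local Open Scope card_scope.

Local Notation lift := Defs.lift.

(** * Syntax *)

Lemma eq_noarg (T : 'I_0 -> Type) (ts : forall i, T i) : ts = @noarg T.
Proof. by apply: functional_extensionality_dep => -[]. Qed.

Lemma eq_App (Sg : signature) n (w : 'I_n -> sorts Sg) s (f : funs w s)
    (ts us : forall i, term (w i)) :
  (forall i, ts i = us i) -> App f ts = App f us.
Proof. by move=> tsus; congr App; exact: functional_extensionality_dep. Qed.

Lemma App_cst (Sg : signature) (C : sorts Sg -> Type) (w : 'I_0 -> sorts Sg)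
    s (c : C s) ts :
  @App (ext C) 0 w s (inr c) ts = Defs.cst c.
Proof.
have we : w = fun=> s by apply: funext => -[].
by move: ts; case: _ / (esym we) => ts; rewrite (eq_noarg ts).
Qed.

(* The induction principle generated for sentences has no hypothesis for the
   members of a disjunction. *)
Lemma sen_nested_ind (P : forall Sg, sen Sg -> Prop) :
  (forall Sg s (t1 t2 : term (Sg := Sg) s), P Sg (Eq t1 t2)) ->
  (forall Sg s a (t1 t2 : term (Sg := Sg) s), P Sg (Tr a t1 t2)) ->
  (forall Sg phi, P Sg phi -> P Sg (Neg phi)) ->
  (forall Sg Phi, (forall phi, List.In phi Phi -> P Sg phi) ->
    P Sg (Disj Phi)) ->
  (forall Sg n (X : 'I_n -> sorts Sg) phi, P (extv Sg X) phi ->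
    P Sg (Ex X phi)) ->
  forall Sg phi, P Sg phi.
Proof.
move=> PEq PTr PNeg PDisj PEx.
fix IH 2 => Sg [s t1 t2|s a t1 t2|phi|Phi|n X phi].
- exact: PEq.
- exact: PTr.
- exact/PNeg/IH.
- apply: PDisj; elim: Phi => [|psi Phi IHPhi] phi /=; first by case.
  by case=> [<-|/IHPhi]; first exact: IH.
- exact/PEx/IH.
Qed.

Lemma action_pow_ind (L : Type) (P : action L -> Prop) :
  (forall l, P (Lbl l)) ->
  (forall a b, P a -> P b -> P (Comp a b)) ->
  (forall a b, P a -> P b -> P (Cup a b)) ->
  (forall a, (forall n, P (act_powS a n)) -> P (Star a)) ->
  forall a, P a.
Proof.
move=> PLbl PComp PCup PStar.
elim=> [l|a Pa b Pb|a Pa b Pb|a Pa]; [exact: PLbl|exact: PComp|exact: PCup|].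
by apply: PStar; elim=> [//|n IHn]; exact: PComp.
Qed.

Lemma act_map_comp (L1 L2 L3 : Type) (g : L1 -> L2) (h : L2 -> L3)
    (a : action L1) :
  act_map h (act_map g a) = act_map (fun l => h (g l)) a.
Proof. by elim: a => //= [a -> b ->|a -> b ->|a ->]. Qed.

Lemma act_map_id (L : Type) (a : action L) : act_map id a = a.
Proof. by elim: a => //= [a -> b ->|a -> b ->|a ->]. Qed.

(** * Substitutions *)

Lemma subst_ext (S1 S2 : signature) (g : sorts S1 -> sorts S2)
    (f1 f2 : forall n (w : 'I_n -> sorts S1) (s : sorts S1), funs w s ->
      (funs (fun i => g (w i)) (g s) + arity0 (term (g s)) n)%type)
    (l : labels S1 -> labels S2) :
  (forall n (w : 'I_n -> sorts S1) s (f : funs w s), f1 n w s f = f2 n w s f) ->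
  Subst f1 l = Subst f2 l.
Proof.
move=> f12; congr Subst.
by do 4! (apply: functional_extensionality_dep => ?); exact: f12.
Qed.

Definition id_subst (Sg : signature) : subst Sg Sg :=
  {| ssort := id; sfun := fun n w s f => inl f; slabel := id |}.

Definition comp_subst (S1 S2 S3 : signature) (th : subst S1 S2)
    (ta : subst S2 S3) : subst S1 S3 :=
  {| ssort := fun s => ssort ta (ssort th s);
     sfun := fun n w s f =>
       match sfun th f with
       | inl g => sfun ta g
       | inr u => inr (arity0_map (fun t => term_subst ta t) u)
       end;
     slabel := fun l => slabel ta (slabel th l) |}.

Lemma term_subst_id (Sg : signature) s (t : term (Sg := Sg) s) :
  term_subst (id_subst Sg) t = t.
Proof. by elim: t => n w s' f ts IH /=; exact: eq_App. Qed.

Lemma term_subst_comp (S1 S2 S3 : signature) (th : subst S1 S2)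
    (ta : subst S2 S3) s (t : term (Sg := S1) s) :
  term_subst ta (term_subst th t) = term_subst (comp_subst th ta) t.
Proof.
elim: t => n w s' f ts IH /=.
case: (sfun th f) => [g|u] /=; last by case: n w f ts IH u.
by case: (sfun ta g) => // h; exact: eq_App.
Qed.

Lemma eq_vars (S : Type) n (X : 'I_n -> S) s (x y : vars X s) :
  sval x = sval y -> x = y.
Proof. by case: x y => [i ?] [j ?]; exact: eq_exist. Qed.

Lemma vars_map_id (S : Type) n (X : 'I_n -> S) s (x : vars X s) :
  vars_map id x = x.
Proof. by case: x => i e; exact: eq_vars. Qed.

Lemma lift_id (Sg : signature) n (X : 'I_n -> sorts Sg) :
  lift (id_subst Sg) X = id_subst (extv Sg X).
Proof.
apply: subst_ext => m w s [f //|x] /=; congr inl; congr inr.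
by case: m w x => [|m] //= w x; exact: vars_map_id.
Qed.

Lemma term_lift_incl (S1 S2 : signature) (th : subst S1 S2) n
    (X : 'I_n -> sorts S1) s (t : term (Sg := S1) s) :
  term_subst (lift th X) (uptv X t) =
  uptv (fun i => ssort th (X i)) (term_subst th t).
Proof. by rewrite /term_tr [LHS]term_subst_comp [RHS]term_subst_comp. Qed.

Lemma lift_comp (S1 S2 S3 : signature) (th : subst S1 S2)
    (ta : subst S2 S3) n (X : 'I_n -> sorts S1) :
  comp_subst (lift th X) (lift ta (fun i => ssort th (X i))) =
  lift (comp_subst th ta) X.
Proof.
apply: subst_ext => m w s [f|x] /=.
  case: (sfun th f) => [//|u]; congr inr; case: m w f u => [|m] //= w f u.
  exact: (term_lift_incl ta (fun i => ssort th (X i)) u).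
congr inl; congr inr; case: m w x => [|m] //= w [i e]; exact: eq_vars.
Qed.

Lemma sen_subst_id (Sg : signature) (phi : sen Sg) :
  sen_subst (id_subst Sg) phi = phi.
Proof.
elim/sen_nested_ind: phi => {Sg} [Sg s t1 t2|Sg s a t1 t2|Sg phi IH|Sg Phi IH|].
- by rewrite /= !term_subst_id.
- by rewrite /= !term_subst_id act_map_id.
- by rewrite /= IH.
- by congr Disj; rewrite -[RHS]List.map_id; exact: List.map_ext_in.
- by move=> Sg n X phi IH; rewrite /= lift_id IH.
Qed.

Lemma sen_subst_comp (S1 S2 S3 : signature) (th : subst S1 S2)
    (ta : subst S2 S3) (phi : sen S1) :
  sen_subst ta (sen_subst th phi) = sen_subst (comp_subst th ta) phi.
Proof.
elim/sen_nested_ind: phi S2 S3 th ta => {S1}.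
- by move=> S1 s t1 t2 S2 S3 th ta; rewrite /= !term_subst_comp.
- by move=> S1 s a t1 t2 S2 S3 th ta; rewrite /= !term_subst_comp act_map_comp.
- by move=> S1 phi IH S2 S3 th ta; rewrite /= IH.
- move=> S1 Phi IH S2 S3 th ta; congr Disj; rewrite -map_comp.
  by apply: List.map_ext_in => phi /IH; exact.
- by move=> S1 n X phi IH S2 S3 th ta; rewrite /= IH lift_comp.
Qed.

(* A substitution may send a constant to a symbol or to the term formed by that
   symbol; normalization always chooses the term. *)
Definition norm_cst (Sg : signature) n (w : 'I_n -> sorts Sg) (s : sorts Sg) :
    funs w s + arity0 (term s) n -> funs w s + arity0 (term s) n :=
  match n return forall w : 'I_n -> sorts Sg,
    funs w s + arity0 (term s) n -> funs w s + arity0 (term s) n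
  with
  | 0 => fun w u => if u is inl g then inr (App g (@noarg _)) else u
  | _.+1 => fun w u => u
  end w.

Definition norm_subst (S1 S2 : signature) (th : subst S1 S2) : subst S1 S2 :=
  {| ssort := ssort th;
     sfun := fun n w s f => norm_cst (sfun th f);
     slabel := slabel th |}.

Lemma term_subst_norm (S1 S2 : signature) (th : subst S1 S2) s
    (t : term (Sg := S1) s) : term_subst (norm_subst th) t = term_subst th t.
Proof.
elim: t => n w s' f ts IH /=.
case: n w f ts IH => [|n] w f ts IH; case: (sfun th f) => //= g; apply: eq_App.
  by case.
exact: IH.
Qed.

Lemma norm_lift (S1 S2 : signature) (th : subst S1 S2) n
    (X : 'I_n -> sorts S1) :
  norm_subst (lift (norm_subst th) X) = norm_subst (lift th X).
Proof.
apply: subst_ext => -[|m] w s [f|x] //=; case: (sfun th f) => //= g.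
by congr inr; apply: eq_App => -[].
Qed.

Lemma sen_subst_norm (S1 S2 : signature) (th : subst S1 S2) (phi : sen S1) :
  sen_subst (norm_subst th) phi = sen_subst th phi.
Proof.
elim/sen_nested_ind: phi S2 th => {S1}.
- by move=> S1 s t1 t2 S2 th; rewrite /= !term_subst_norm.
- by move=> S1 s a t1 t2 S2 th; rewrite /= !term_subst_norm.
- by move=> S1 phi IH S2 th; rewrite /= IH.
- move=> S1 Phi IH S2 th; congr Disj.
  by apply: List.map_ext_in => phi /IH; exact.
- by move=> S1 n X phi IH S2 th; rewrite /= -[in LHS]IH norm_lift IH.
Qed.

Lemma eq_norm_sen_subst (S1 S2 : signature) (th ta : subst S1 S2) phi :
  norm_subst th = norm_subst ta -> sen_subst th phi = sen_subst ta phi.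
Proof. by move=> thta; rewrite -sen_subst_norm thta sen_subst_norm. Qed.

Lemma term_inst_incl (Sg : signature) (C : sorts Sg -> Type)
    (th : forall s, C s -> term s) s (t : term (Sg := Sg) s) :
  term_subst (inst th) (term_tr (ext_incl C) t) = t.
Proof.
exact: (etrans (term_subst_comp (subst_of_mor (ext_incl C)) (inst th) t)
  (term_subst_id t)).
Qed.

Section ExtMap.
Variables (Sg : signature) (A B C : sorts Sg -> Type).

Lemma ext_map_id (g : forall s, A s -> A s) :
  (forall s, g s =1 id) -> subst_of_mor (ext_map g) = id_subst (ext A).
Proof.
move=> gid; apply: subst_ext => n w s [//|x] /=; congr inl; congr inr.
by case: n w x => [|n] //= w x; exact: gid.
Qed.

Lemma ext_map_comp (g : forall s, A s -> B s) (h : forall s, B s -> C s)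
    (k : forall s, A s -> C s) :
  (forall s, h s \o g s =1 k s) ->
  comp_subst (subst_of_mor (ext_map g)) (subst_of_mor (ext_map h)) =
  subst_of_mor (ext_map k).
Proof.
move=> hgk; apply: subst_ext => n w s [//|x] /=; congr inl; congr inr.
by case: n w x => [|n] //= w x; exact: hgk.
Qed.

Lemma inst_ext_map (g : forall s, A s -> B s) n (X : 'I_n -> sorts Sg)
    (th : forall s, vars X s -> term (Sg := ext A) s) :
  comp_subst (inst (Sg := ext A) th) (subst_of_mor (ext_map g)) =
  comp_subst (lift (subst_of_mor (ext_map g)) X)
    (inst (Sg := ext B) (fun s x => term_tr (ext_map g) (th s x))).
Proof.
apply: subst_ext => m w s [[f|x]|x] //=; congr inr; case: m w x => [|m] //= w x.
by rewrite vars_map_id.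
Qed.

End ExtMap.

(** * Entailment *)

Definition consistent (Sg : signature) (G : set (sen Sg)) : Prop := ~ G |-1 bot.

Section Entailment.
Variable Sg : signature.
Implicit Types (G H : set (sen Sg)) (phi psi : sen Sg).

Lemma entails_ax G phi : G phi -> G |-1 phi.
Proof. by move=> Gphi; apply: Monotonicity => _ ->. Qed.

Lemma entails_weaken G H phi : G `<=` H -> G |-1 phi -> H |-1 phi.
Proof. by move=> GH; apply: Transitivity; exact: Monotonicity. Qed.

Lemma entails_cut G phi psi :
  G |-1 phi -> G `|` [set phi] |-1 psi -> G |-1 psi.
Proof.
move=> Gphi; apply: Transitivity; apply: Unions => chi [/entails_ax //|->//].
Qed.

Lemma entails_contra G phi : G `|` [set Neg phi] |-1 bot -> G |-1 phi.
Proof. by move=> h; apply: Neg_D; exact: Neg_I. Qed.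

Lemma consistent_Neg_False G phi :
  consistent G -> G |-1 phi -> G |-1 Neg phi -> False.
Proof. by move=> consG Gphi /Neg_E /(entails_cut Gphi). Qed.

End Entailment.

Lemma entails_tr (S1 S2 : signature) (chi : morphism S1 S2) (G : set (sen S1))
    (H : set (sen S2)) phi :
  sen_tr chi @` G `<=` H -> G |-1 phi -> H |-1 sen_tr chi phi.
Proof.
by move=> GH /(Translation chi); rewrite image_set1; exact: entails_weaken.
Qed.

Lemma consistent_retract (S1 S2 : signature) (chi : morphism S1 S2)
    (rho : morphism S2 S1) (G : set (sen S1)) :
  cancel (sen_tr chi) (sen_tr rho) ->
  consistent G -> consistent (sen_tr chi @` G).
Proof.
move=> chiK consG /(@entails_tr _ _ rho _ G) ent; apply/consG/ent.
by move=> _ [_ [phi Gphi <-] <-]; rewrite chiK.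
Qed.

(** * Nested extensions by constants *)

Section Merge.
Variables (Sg : signature) (A B E : sorts Sg -> Type).
Variable g : forall s, A s + B s -> E s.

Definition merge_fun n (w : 'I_n -> sorts Sg) (s : sorts Sg)
    (f : @funs (@ext (ext A) B) _ w s) : @funs (ext E) _ w s :=
  match f with
  | inl (inl f) => inl f
  | inl (inr x) => inr (arity0_map (fun x => g (inl x)) x)
  | inr x => inr (arity0_map (fun x => g (inr x)) x)
  end.

Lemma merge_mono n (w : 'I_n -> sorts Sg) (s : sorts Sg)
    (f : @funs (@ext (ext A) B) _ w s) :
  monotonic f -> monotonic (merge_fun f).
Proof. by case: f => [[]|]. Qed.

Definition merge : morphism (@ext (ext A) B) (ext E) :=
  {| msort := id : sorts (@ext (ext A) B) -> sorts (ext E);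
     mfun := merge_fun;
     mlabel := id : labels (@ext (ext A) B) -> labels (ext E);
     mmono := merge_mono |}.

Lemma merge_ext_incl :
  comp_subst (subst_of_mor (ext_incl (Sg := ext A) B)) (subst_of_mor merge) =
  subst_of_mor (ext_map (fun s x => g (inl x))).
Proof. by apply: subst_ext => n w s []. Qed.

Variable d : forall s, E s -> A s + B s.

Definition unmerge_cst n (s : sorts Sg) :
    arity0 (E s) n -> (arity0 (A s) n + arity0 (B s) n)%type :=
  match n with
  | 0 => @d s
  | _.+1 => fun v => match v with end
  end.

Definition unmerge_fun n (w : 'I_n -> sorts Sg) (s : sorts Sg)
    (f : @funs (ext E) _ w s) : @funs (@ext (ext A) B) _ w s :=
  match f with
  | inl f => inl (inl f)
  | inr x =>
      match unmerge_cst x with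
      | inl y => inl (inr y)
      | inr y => inr y
      end
  end.

Lemma unmerge_mono n (w : 'I_n -> sorts Sg) (s : sorts Sg)
    (f : @funs (ext E) _ w s) :
  monotonic f -> monotonic (unmerge_fun f).
Proof. by case: f. Qed.

Definition unmerge : morphism (ext E) (@ext (ext A) B) :=
  {| msort := id : sorts (ext E) -> sorts (@ext (ext A) B);
     mfun := unmerge_fun;
     mlabel := id : labels (ext E) -> labels (@ext (ext A) B);
     mmono := unmerge_mono |}.

Lemma mergeK :
  (forall s, cancel (@g s) (@d s)) -> cancel (sen_tr merge) (sen_tr unmerge).
Proof.
move=> gK phi; rewrite /sen_tr sen_subst_comp -[RHS]sen_subst_id.
congr sen_subst; apply: subst_ext => n w s [[//|x]|x] /=; congr inl;
  by case: n w x => [|n] //= w x; rewrite gK.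
Qed.

End Merge.

Lemma merge_inst (Sg : signature) (A E : sorts Sg -> Type) n
    (X : 'I_n -> sorts Sg) (g : forall s, A s + vars X s -> E s)
    (phi : sen (extv (ext A) X)) :
  sen_tr (merge g) phi =
  sen_subst
    (inst (Sg := ext E) (C := vars X) (fun s x => Defs.cst (g s (inr x))))
    (sen_subst (lift (subst_of_mor (ext_map (fun s x => g s (inl x)))) X) phi).
Proof.
rewrite sen_subst_comp; apply: eq_norm_sen_subst.
apply: subst_ext => -[|m] w s [[f|x]|x] //=.
by rewrite vars_map_id App_cst.
Qed.

(** * Fresh constants *)

Lemma existT_inj (I : Type) (T : I -> Type) i : injective (existT T i).
Proof.
move=> x y xy; have := projT2_eq xy.
by rewrite (Prop_irrelevance (projT1_eq xy) erefl).
Qed.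

Lemma infinite_transversal (T : Type) n (A : 'I_n -> set T) :
  (forall i, infinite_set (A i)) ->
  exists2 f : 'I_n -> T, injective f & forall i, A i (f i).
Proof.
elim: n A => [|n IHn] A infA; first by exists (@noarg _) => -[].
have [f f_inj Af] := IHn _ (fun i => infA (fintype.lift ord0 i)).
have /infinite_setN0 [x [Ax fx]] :
    infinite_set (A ord0 `\` range f).
  by apply: infinite_setD => //; exact: finite_image.
exists (fun i => if unlift ord0 i is Some j then f j else x).
  move=> i j; case: unliftP => [i' ->|->]; case: unliftP => [j' ->|->] //.
  - by move=> /f_inj ->.
  - by move=> fE; case: fx; exists i'.
  - by move=> fE; case: fx; exists j'.
by move=> i; case: unliftP => [j|] ->.
Qed.

Lemma fresh_constants (S : Type) (C : S -> Type) (D : set {s : S & C s})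
    n (X : 'I_n -> S) :
  (forall s, infinite_set [set: C s]) -> finite_set D ->
  exists2 c : forall i, C (X i), injective (fun i => existT C (X i) (c i)) &
    forall i, ~ D (existT C (X i) (c i)).
Proof.
move=> infC finD.
pose A i := range (existT C (X i)) `\` D.
have [i|f f_inj Af] := @infinite_transversal _ _ A.
  apply: infinite_setD => // fin; apply: (infC (X i)).
  rewrite -(eq_finite_set (inj_card_eq (f := existT C (X i)) _)) // => x y _ _.
  exact: existT_inj.
have c i : {c | existT C (X i) c = f i}.
  by case: (Af i) => /cid2 [c _ <-] _; exists c.
exists (fun i => sval (c i)) => [i j|i]; rewrite !(svalP (c _)).
  exact: f_inj.
by have [] := Af i.
Qed.

Section FreshConstants.
Variables (Sg : signature) (C : sorts Sg -> Type).
Variables (D : set {s : sorts Sg & C s}) (n : nat) (X : 'I_n -> sorts Sg).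
Variable c : forall i, C (X i).

Definition adjoin : set {s : sorts Sg & C s} :=
  D `|` range (fun i => existT C (X i) (c i)).

Definition adjoin_cst s (u : Delta_consts D s + vars X s) :
    Delta_consts adjoin s :=
  match u with
  | inl x => Delta_incl_fun (@subsetUl _ _ _) x
  | inr (exist i e) =>
      match e in _ = s return Delta_consts adjoin s with
      | erefl => exist _ (c i) (mem_set (or_intror (imageT _ i)))
      end
  end.

Lemma val_adjoin_vars s (x : vars X s) :
  existT C s (val (adjoin_cst (inr x))) = existT C (X (sval x)) (c (sval x)).
Proof. by case: x => i e; case: s / e. Qed.

Hypothesis c_inj : injective (fun i => existT C (X i) (c i)).
Hypothesis c_fresh : forall i, ~ D (existT C (X i) (c i)).

Lemma adjoin_cst_inj s : injective (@adjoin_cst s).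
Proof.
have old_new x y : adjoin_cst (inl x) <> adjoin_cst (inr y) :> Delta_consts _ s.
  move=> xy; apply: (c_fresh (i := sval y)).
  by rewrite -val_adjoin_vars -xy; exact: set_mem (valP x).
move=> [x|x] [y|y] xy.
- by congr inl; apply: val_inj; move/(congr1 val): xy.
- by case: (old_new _ _ xy).
- by case: (old_new _ _ (esym xy)).
- congr inr; apply/eq_vars/c_inj.
  by rewrite -!val_adjoin_vars xy.
Qed.

Lemma adjoin_cst_surj s (y : Delta_consts adjoin s) :
  exists x, adjoin_cst x = y.
Proof.
have [Dy|[i _ iy]] := set_mem (valP y).
  by exists (inl (exist _ (val y) (mem_set Dy))); exact: val_inj.
exists (inr (exist _ i (congr1 (@projT1 _ _) iy))).
by apply/val_inj/existT_inj; rewrite val_adjoin_vars.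
Qed.

Lemma adjoin_cst_can :
  exists d : forall s, Delta_consts adjoin s -> Delta_consts D s + vars X s,
    forall s, cancel (@adjoin_cst s) (d s).
Proof.
pose d s (y : Delta_consts adjoin s) := sval (cid (adjoin_cst_surj y)).
exists d => s; apply: inj_can_sym (@adjoin_cst_inj s) => y.
exact: svalP (cid (adjoin_cst_surj y)).
Qed.

End FreshConstants.

(** * Conditions *)

(* Labels do not change with the condition, so the signature of a transition
   must come from its expected type rather than from its action. *)
Local Arguments Tr {Sg s} & a t1 t2.

Section Conditions.
Variables (Sg : signature) (C : sorts Sg -> Type).
Implicit Types p q r : condition C.

Lemma sen_tr_Delta_incl_id (D : set {s : sorts Sg & C s}) (DD : D `<=` D)
    (phi : sen (Delta D)) :
  sen_tr (Delta_incl DD) phi = phi.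
Proof.
rewrite /sen_tr -[RHS]sen_subst_id; congr sen_subst.
by apply: ext_map_id => s x; exact: val_inj.
Qed.

Lemma sen_tr_Delta_incl_comp (D1 D2 D3 : set {s : sorts Sg & C s})
    (D12 : D1 `<=` D2) (D23 : D2 `<=` D3) (D13 : D1 `<=` D3)
    (phi : sen (Delta D1)) :
  sen_tr (Delta_incl D23) (sen_tr (Delta_incl D12) phi) =
  sen_tr (Delta_incl D13) phi.
Proof.
rewrite /sen_tr sen_subst_comp; congr sen_subst.
by apply: ext_map_comp => s x; exact: val_inj.
Qed.

Lemma cond_le_refl p : cond_le p p.
Proof.
by exists (fun _ => id) => _ [phi pphi <-]; rewrite sen_tr_Delta_incl_id.
Qed.

Lemma cond_le_trans p q r : cond_le p q -> cond_le q r -> cond_le p r.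
Proof.
move=> [pq axs_pq] [qr axs_qr].
have pr := subset_trans pq qr; exists pr => _ [phi pphi <-].
rewrite -(sen_tr_Delta_incl_comp pq qr); apply/axs_qr/imageP.
by apply: axs_pq; exists phi.
Qed.

Definition le_term p q (h : cond_le p q) (s : sorts Sg)
    (t : term (Sg := Delta_of p) s) : term (Sg := Delta_of q) s :=
  term_tr (Delta_incl (le_consts h)) t.

Definition le_tr p q (h : cond_le p q) : sen (Delta_of p) -> sen (Delta_of q) :=
  sen_tr (Delta_incl (le_consts h)).

Lemma le_tr_id p (h : cond_le p p) phi : le_tr h phi = phi.
Proof. exact: sen_tr_Delta_incl_id. Qed.

Lemma le_tr_comp p q r (hpq : cond_le p q) (hqr : cond_le q r)
    (hpr : cond_le p r) phi : le_tr hqr (le_tr hpq phi) = le_tr hpr phi.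
Proof. exact: sen_tr_Delta_incl_comp. Qed.

Lemma depth_le_tr p q (h : cond_le p q) phi : depth (le_tr h phi) = depth phi.
Proof. exact: depth_subst. Qed.

Lemma le_tr_Tr p q (h : cond_le p q) s a (t1 t2 : term (Sg := Delta_of p) s) :
  le_tr h (Tr a t1 t2) = Tr a (le_term h t1) (le_term h t2).
Proof. by rewrite /le_tr /sen_tr /= act_map_id. Qed.

Lemma le_tr_Tr_pow p q (h : cond_le p q) s a k
    (t1 t2 : term (Sg := Delta_of p) s) :
  le_tr h (Tr_pow (Sg := Delta_of p) a k t1 t2) =
  Tr_pow (Sg := Delta_of q) a k (le_term h t1) (le_term h t2).
Proof. by case: k => [//|k]; exact: le_tr_Tr. Qed.

Definition le_lift p q (h : cond_le p q) n (X : 'I_n -> sorts Sg) :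
    sen (extv (Delta_of p) X) -> sen (extv (Delta_of q) X) :=
  sen_subst (lift (subst_of_mor (Delta_incl (le_consts h))) X).

Lemma le_tr_inst p q (h : cond_le p q) n (X : 'I_n -> sorts Sg)
    (th : forall s, vars X s -> term (Sg := Delta_of p) s)
    (phi : sen (extv (Delta_of p) X)) :
  le_tr h (sen_subst (inst (Sg := Delta_of p) th) phi) =
  sen_subst (inst (Sg := Delta_of q) (fun s x => le_term h (th s x)))
    (le_lift h phi).
Proof. by rewrite /le_tr /sen_tr /le_lift !sen_subst_comp inst_ext_map. Qed.

Definition proves p (phi : sen (Delta_of p)) : Prop := axs p |-1 phi.

Lemma proves_ax p (phi : sen (Delta_of p)) : axs p phi -> proves phi.
Proof. exact: entails_ax. Qed.

Lemma le_axs_tr p q (h : cond_le p q) phi : axs p phi -> axs q (le_tr h phi).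
Proof. by move=> pphi; exact: (@le_axs _ _ _ _ h _ (imageP _ pphi)). Qed.

Lemma proves_le p q (h : cond_le p q) phi : proves phi -> proves (le_tr h phi).
Proof. exact/entails_tr/le_axs. Qed.

Lemma proves_Neg_False p (phi : sen (Delta_of p)) :
  proves phi -> proves (Neg phi) -> False.
Proof. exact/consistent_Neg_False/axs_consistent. Qed.

Lemma extend_axiom p (phi : sen (Delta_of p)) :
  consistent (axs p `|` [set phi]) ->
  exists q (h : cond_le p q), axs q (le_tr h phi).
Proof.
move=> cons; pose q := Condition (consts_finite p) cons.
have pq : cond_le p q.
  have sub_pq : consts p `<=` consts q by [].
  exists sub_pq => _ [psi ppsi <-].
  by left; rewrite sen_tr_Delta_incl_id.
by exists q, pq; right; rewrite /le_tr sen_tr_Delta_incl_id.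
Qed.

Lemma proves_dense p (phi : sen (Delta_of p)) :
  (forall q (pq : cond_le p q),
    exists r (qr : cond_le q r), proves (le_tr qr (le_tr pq phi))) ->
  proves phi.
Proof.
move=> dense; apply: entails_contra; apply: contrapT.
move=> /extend_axiom [q [pq /proves_ax negphi]].
have [r [qr]] := dense q pq.
by move=> /proves_Neg_False; apply; exact: (proves_le qr negphi).
Qed.

Lemma extend_proved p (phi : sen (Delta_of p)) :
  proves phi -> exists q (h : cond_le p q), axs q (le_tr h phi).
Proof.
by move=> ent; apply: extend_axiom => /(entails_cut ent); exact: axs_consistent.
Qed.

Lemma extend_family p (I : Type) (F : I -> sen (Delta_of p)) :
  ((forall i, axs p `|` [set F i] |-1 bot) -> proves (p := p) bot) ->
  exists i q (h : cond_le p q), axs q (le_tr h (F i)).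
Proof.
move=> inconsF; apply: contrapT => none; apply: (axs_consistent (c := p)).
apply: inconsF => i; apply: contrapT => /extend_axiom [q [pq ax]].
by apply: none; exists i, q, pq.
Qed.

Lemma extend_Cup p s a b (t1 t2 : term (Sg := Delta_of p) s) :
  proves (Tr (Cup a b) t1 t2) ->
  exists (c : bool) q (h : cond_le p q),
    axs q (le_tr h (Tr (if c then a else b) t1 t2)).
Proof.
move=> ent; apply: extend_family => incons.
exact: Union_E ent (incons true) (incons false).
Qed.

Lemma extend_Star p s a (t1 t2 : term (Sg := Delta_of p) s) :
  proves (Tr (Star a) t1 t2) ->
  exists n q (h : cond_le p q), axs q (le_tr h (Tr_pow a n t1 t2)).
Proof. by move=> ent; apply: extend_family; exact: Star_E ent. Qed.

Lemma extend_Disj p (Phi : seq (sen (Delta_of p))) :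
  proves (Disj Phi) ->
  exists2 phi, List.In phi Phi &
    exists q (h : cond_le p q), axs q (le_tr h phi).
Proof.
move=> ent; have [|[phi inPhi] ext] := @extend_family p
    {phi | List.In phi Phi} sval; last by exists phi.
move=> incons; apply: Disj_E ent _ => phi inPhi.
exact: (incons (exist _ phi inPhi)).
Qed.

Hypothesis infC : forall s : sorts Sg, infinite_set [set: C s].

Lemma extend_constants p n (X : 'I_n -> sorts (Delta_of p))
    (G : set (sen (extv (Delta_of p) X))) :
  consistent (upv X @` axs p `|` G) ->
  exists q (h : cond_le p q)
    (th : forall s, vars X s -> term (Sg := Delta_of q) s),
    forall phi, G phi ->
      axs q (sen_subst (inst (Sg := Delta_of q) th) (le_lift h phi)).
Proof.
move=> cons; have [c c_inj c_fresh] := fresh_constants X infC (consts_finite p).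
have [d gK] := adjoin_cst_can (Sg := Sg) c_inj c_fresh.
pose g := @adjoin_cst Sg C (consts p) n X c.
have fin : finite_set (adjoin (consts p) c).
  by rewrite finite_setU; split; [exact: consts_finite | exact: finite_image].
pose q := Condition fin (consistent_retract (mergeK gK) cons).
have pq : cond_le p q.
  exists (@subsetUl _ _ _ : consts p `<=` consts q) => _ [phi pphi <-].
  exists (upv X phi); first by left; exists phi.
  by rewrite /sen_tr sen_subst_comp merge_ext_incl.
exists q, pq, (fun s x => Defs.cst (g s (inr x))) => phi Gphi.
exists phi; first by right.
rewrite merge_inst /le_lift.
by rewrite (Prop_irrelevance (le_consts pq) (@subsetUl _ _ _)).
Qed.

Lemma extend_Comp p s a b (t1 t2 : term (Sg := Delta_of p) s) :
  proves (Tr (Comp a b) t1 t2) ->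
  exists q (h : cond_le p q) (u : term (Sg := Delta_of q) s),
    axs q (Tr a (le_term h t1) u) /\ axs q (Tr b u (le_term h t2)).
Proof.
move=> ent.
have /extend_constants [q [pq [th ax]]] :
    consistent (upv (var1 (Sg := Delta_of p) s) @` axs p `|`
      [set Tr (Sg := extv (Delta_of p) (var1 s)) a (uptv (var1 s) t1) (x1 s);
           Tr (Sg := extv (Delta_of p) (var1 s)) b (x1 s) (uptv (var1 s) t2)]).
  by move=> /(@Comp_E _ _ _ _ _ _ _ bot ent); exact: axs_consistent.
pose inst_th (t : term (Sg := extv (Delta_of p) (var1 s)) s) :=
  term_subst (inst (Sg := Delta_of q) th)
    (term_subst (lift (subst_of_mor (Delta_incl (le_consts pq))) (var1 s)) t).
have inst_upE (t : term (Sg := Delta_of p) s) :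
    inst_th (uptv (var1 s) t) = le_term pq t.
  by rewrite /inst_th term_lift_incl; exact: term_inst_incl.
exists q, pq, (inst_th (x1 s)); rewrite -!inst_upE.
by split; [have := ax _ (or_introl erefl)|have := ax _ (or_intror erefl)];
  rewrite /le_lift /= !act_map_id.
Qed.

Lemma extend_Ex p n (X : 'I_n -> sorts (Delta_of p))
    (phi : sen (extv (Delta_of p) X)) :
  proves (Ex X phi) ->
  exists q (h : cond_le p q)
    (th : forall s, vars X s -> term (Sg := Delta_of q) s),
    axs q (sen_subst (inst (Sg := Delta_of q) th) (le_lift h phi)).
Proof.
move=> ent; have /extend_constants [q [pq [th ax]]] :
    consistent (upv X @` axs p `|` [set phi]).
  by move=> /(@Quant_I _ _ _ _ _ bot) /(entails_cut ent); exact: axs_consistent.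
by exists q, pq, th; exact: ax.
Qed.

(** * Forcing *)

Lemma sen_depth_ind (P : forall p, sen (Delta_of p) -> Prop) :
  (forall p phi,
    (forall q (psi : sen (Delta_of q)), depth psi < depth phi -> P q psi) ->
    P p phi) ->
  forall p phi, P p phi.
Proof.
move=> step p phi; have [k] := ubnP (depth phi).
elim: k p phi => // k IHk p phi phik; apply: step => q psi psiphi.
exact/IHk/(leq_trans psiphi).
Qed.

Lemma forces_Tr_le p q (h : cond_le p q) s a
    (t1 t2 : term (Sg := Delta_of p) s) :
  forces p (Tr a t1 t2) -> forces q (le_tr h (Tr a t1 t2)).
Proof.
rewrite le_tr_Tr.
elim/action_pow_ind: a t1 t2 => [l|a b IHa IHb|a b IHa IHb|a IHa] t1 t2.
- by rewrite !forces_Lbl => -[/(le_axs_tr h) ax _]; split.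
- move=> /forces_Comp [t [/IHa Fa /IHb Fb]].
  by apply/forces_Comp; exists (le_term h t).
- by move=> /forces_Cup [/IHa|/IHb] F; apply/forces_Cup; [left|right].
- move=> /forces_Star [[|n] F]; apply/forces_Star.
    by exists 0; case: F => /(le_axs_tr h) ax _; split.
  by exists n.+1; exact: IHa.
Qed.

Lemma forces_le p q (h : cond_le p q) phi :
  forces p phi -> forces q (le_tr h phi).
Proof.
elim/sen_depth_ind: p / phi q h => p [s t1 t2|s a t1 t2|phi|Phi|n X phi] IH q h.
- by move=> [/(le_axs_tr h) ax _]; split.
- exact: forces_Tr_le.
- move=> /forces_Neg F; apply/forces_Neg => r qr.
  have pr := cond_le_trans h qr.
  rewrite -[sen_tr _ _]/(le_tr qr (le_tr h phi)) (le_tr_comp h qr pr).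
  exact: F.
- move=> /forces_Disj [phi [inPhi F]]; apply/forces_Disj.
  exists (le_tr h phi); split; first exact: List.in_map.
  by apply: IH F; exact: depth_Disj.
- move=> /forces_Ex [th F]; apply/forces_Ex.
  exists (fun s x => le_term h (th s x)).
  by have := IH p _ _ q h F; rewrite le_tr_inst depth_subst; apply.
Qed.

Definition forced_above p phi : Prop :=
  exists q (h : cond_le p q), forces q (le_tr h phi).

Lemma forced_above_le p q (h : cond_le p q) phi :
  forced_above (le_tr h phi) -> forced_above phi.
Proof.
move=> [r [qr F]]; exists r, (cond_le_trans h qr).
by rewrite -(le_tr_comp h qr).
Qed.

Lemma forces_forced_above p (phi : sen (Delta_of p)) :
  forces p phi -> forced_above phi.
Proof. by move=> F; exists p, (cond_le_refl p); rewrite le_tr_id. Qed.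

Lemma forced_above_Comp p s a b (t1 t t2 : term (Sg := Delta_of p) s) :
  forced_above (Tr a t1 t) ->
  (forall q (h : cond_le p q), forced_above (le_tr h (Tr b t t2))) ->
  forced_above (Tr (Comp a b) t1 t2).
Proof.
move=> [q [pq Fa]] /(_ q pq) [r [qr Fb]]; apply: (forced_above_le (h := pq)).
exists r, qr; move: Fb (forces_le qr Fa); rewrite !le_tr_Tr => Fb Fa'.
by apply/forces_Comp; exists (le_term qr (le_term pq t)).
Qed.

Lemma forced_above_Cup p (c : bool) s a b (t1 t2 : term (Sg := Delta_of p) s) :
  forced_above (Tr (if c then a else b) t1 t2) ->
  forced_above (Tr (Cup a b) t1 t2).
Proof.
move=> [q [pq]]; rewrite le_tr_Tr => F; exists q, pq; rewrite le_tr_Tr.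
by apply/forces_Cup; case: c F; [left|right].
Qed.

Lemma forced_above_Star p n s a (t1 t2 : term (Sg := Delta_of p) s) :
  forced_above (Tr_pow a n t1 t2) -> forced_above (Tr (Star a) t1 t2).
Proof.
move=> [q [pq]]; rewrite le_tr_Tr_pow => F; exists q, pq; rewrite le_tr_Tr.
by apply/forces_Star; exists n.
Qed.

Lemma forced_above_Disj p (Phi : seq (sen (Delta_of p))) phi :
  List.In phi Phi -> forced_above phi -> forced_above (Disj Phi).
Proof.
move=> inPhi [q [pq F]]; exists q, pq; apply/forces_Disj.
by exists (le_tr pq phi); split=> //; exact: List.in_map.
Qed.

Lemma forced_above_Ex p n (X : 'I_n -> sorts (Delta_of p))
    (th : forall s, vars X s -> term (Sg := Delta_of p) s)
    (phi : sen (extv (Delta_of p) X)) :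
  forced_above (sen_subst (inst (Sg := Delta_of p) th) phi) ->
  forced_above (Ex X phi).
Proof.
move=> [q [pq]]; rewrite le_tr_inst => F; exists q, pq; apply/forces_Ex.
by exists (fun s x => le_term pq (th s x)).
Qed.

Lemma weak_forcesP p (phi : sen (Delta_of p)) :
  weak_forces p phi <->
  forall q (h : cond_le p q), forced_above (le_tr h phi).
Proof.
rewrite /weak_forces; split=> [/forces_Neg notneg q pq|above].
  apply: contrapT => none; apply: (notneg q pq); apply/forces_Neg => r qr F.
  by apply: none; exists r, qr.
apply/forces_Neg => q pq /forces_Neg neg; have [r [qr]] := above q pq.
exact: neg.
Qed.

Lemma forces_Tr_proves p s a (t1 t2 : term (Sg := Delta_of p) s) :
  forces p (Tr a t1 t2) -> proves (Tr a t1 t2).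
Proof.
elim/action_pow_ind: a t1 t2 => [l|a b IHa IHb|a b IHa IHb|a IHa] t1 t2.
- by move=> [ax _]; exact: proves_ax.
- by move=> /forces_Comp [t [/IHa enta /IHb entb]]; exact: Comp_I enta entb.
- by move=> /forces_Cup [/IHa|/IHb]; [exact: Union_I1 | exact: Union_I2].
- move=> /forces_Star [n F]; apply: (@Star_I _ _ _ _ _ _ n).
  by case: n F => [[ax _]|n]; [exact: proves_ax|exact: IHa].
Qed.

Lemma proves_Eq_forced_above p s (t1 t2 : term (Sg := Delta_of p) s) :
  proves (Eq t1 t2) -> forced_above (Eq t1 t2).
Proof. by move=> /extend_proved [q [pq ax]]; exists q, pq; split. Qed.

Lemma proves_Tr_forced_above p s (a : action (labels Sg))
    (t1 t2 : term (Sg := Delta_of p) s) :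
  proves (Tr a t1 t2) -> forced_above (Tr a t1 t2).
Proof.
elim/action_pow_ind: a p s t1 t2 => [l|a b IHa IHb|a b IHa IHb|a IHa] p s t1 t2.
- by move=> /extend_proved [q [pq ax]]; exists q, pq; split.
- move=> /extend_Comp [q [pq [u [axa axb]]]].
  apply: (forced_above_le (h := pq)); rewrite le_tr_Tr.
  apply: forced_above_Comp (IHa _ _ _ _ (proves_ax axa)) _ => r qr.
  by have := proves_le qr (proves_ax axb); rewrite !le_tr_Tr => /IHb.
- move=> /extend_Cup [c [q [pq /proves_ax]]]; rewrite le_tr_Tr => ent.
  apply: (forced_above_Cup (c := c)); apply: (forced_above_le (h := pq)).
  by rewrite le_tr_Tr; case: c ent => [/IHa|/IHb].
- move=> /extend_Star [n [q [pq /proves_ax]]]; rewrite le_tr_Tr_pow => ent.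
  apply: (forced_above_Star (n := n)); apply: (forced_above_le (h := pq)).
  rewrite le_tr_Tr_pow; case: n ent => [|n]; last exact: IHa.
  exact: proves_Eq_forced_above.
Qed.

Lemma forces_Neg_proves p (phi : sen (Delta_of p)) :
  (forall q (h : cond_le p q),
    proves (le_tr h phi) -> forced_above (le_tr h phi)) ->
  forces p (Neg phi) -> proves (Neg phi).
Proof.
move=> complete /forces_Neg F; apply: Neg_I; apply: contrapT.
move=> /extend_axiom [q [pq /proves_ax /complete /forced_above_le [r [pr]]]].
exact: F.
Qed.

Lemma proves_Neg_forces p (phi : sen (Delta_of p)) :
  (forall q (h : cond_le p q),
    forces q (le_tr h phi) -> proves (le_tr h phi)) ->
  proves (Neg phi) -> forces p (Neg phi).
Proof.
move=> sound ent; apply/forces_Neg => q pq /sound entphi.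
exact: proves_Neg_False entphi (proves_le pq ent).
Qed.

Lemma forces_proves_forced_above p (phi : sen (Delta_of p)) :
  (forces p phi -> proves phi) /\ (proves phi -> forced_above phi).
Proof.
elim/sen_depth_ind: p / phi => p [s t1 t2|s a t1 t2|phi|Phi|n X phi] IH.
- by split=> [[ax _]|]; [exact: proves_ax | exact: proves_Eq_forced_above].
- by split; [exact: forces_Tr_proves | exact: proves_Tr_forced_above].
- have IHphi q (h : cond_le p q) := IH q (le_tr h phi)
    (eq_leq (congr1 succn (depth_le_tr h phi))).
  split=> [|ent].
    by apply: forces_Neg_proves => q h; exact: (IHphi q h).2.
  apply: forces_forced_above; apply: proves_Neg_forces ent => q h.
  exact: (IHphi q h).1.
- split=> [/forces_Disj [phi [inPhi F]]|].
    by apply: Disj_I (inPhi); apply: (IH p phi _).1 F; exact: depth_Disj.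
  move=> /extend_Disj [phi inPhi [q [pq /proves_ax ent]]].
  apply: (forced_above_Disj (inPhi)); apply: (forced_above_le (h := pq)).
  by apply: (IH q _ _).2 ent; rewrite depth_le_tr; exact: depth_Disj.
- split=> [/forces_Ex [th F]|].
    apply: (Rule_Subst (th := th)); apply: (IH p _ _).1 F.
    by rewrite depth_subst.
  move=> /extend_Ex [q [pq [th /proves_ax ent]]].
  apply: (forced_above_le (h := pq)).
  apply: (@forced_above_Ex q n X th (le_lift pq phi)).
  by apply: (IH q _ _).2 ent; rewrite !depth_subst.
Qed.

Lemma forces_proves p (phi : sen (Delta_of p)) : forces p phi -> proves phi.
Proof. exact: (forces_proves_forced_above phi).1. Qed.

Lemma proves_forced_above p (phi : sen (Delta_of p)) :
  proves phi -> forced_above phi.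
Proof. exact: (forces_proves_forced_above phi).2. Qed.

End Conditions.

Theorem theorem5p1 (Sg : signature) (C : sorts Sg -> Type)
    (hSg : countable_signature Sg)
    (hC : forall s : sorts Sg, [set: C s] #= [set: nat])
    (p : condition C) (phi : sen (Delta_of p)) :
  weak_forces p phi <-> entails (axs p) [set phi].
Proof.
have infC s : infinite_set [set: C s].
  by rewrite (eq_finite_set (hC s)); exact: infinite_nat.
split=> [/weak_forcesP above|ent].
  apply: proves_dense => q pq; have [r [qr F]] := above q pq.
  by exists r, qr; exact: forces_proves.
apply/weak_forcesP => q pq; apply: proves_forced_above => //.
exact: proves_le.
Qed.
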